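(* Let $k$ be a field of characteristic $2$ and let $n \geq 1$. Let $\mathfrak{h}_n$ be the Heisenberg Lie algebra of dimension $2n+1$ over $k$. Then \[ \sum_{i \geq 0} \dim_k H_{i}(\mathfrak{h}_n;k)\, t^i = \frac{(1+t^3)(1+t)^{2n} + (t+t^2)(2t)^n}{1+t^2}, \] where the right-hand side, computed with integer coefficients, is a polynomial in $t$.
   Context: The Heisenberg Lie algebra $\mathfrak{h}_n$ over $k$ is the $k$-vector space with basis $\{z, x_1,\dots,x_n, y_1,\dots,y_n\}$ whose only nonzero Lie brackets of basis elements are $[x_i,y_i] = -[y_i,x_i] = z$ for $i=1,\dots,n$. $H_i(\mathfrak{h}_n;k)$ denotes the $i$-th Lie algebra homology of $\mathfrak{h}_n$ with trivial coefficients in $k$, i.e. the $i$-th homology of the Chevalley–Eilenberg complex $\cdots \to \bigwedge^{i}\mathfrak{h}_n \to \bigwedge^{i-1}\mathfrak{h}_n \to \cdots \to \bigwedge^1 \mathfrak{h}_n \to \bigwedge^0\mathfrak{h}_n = k \to 0$ with differential $d(w_1\wedge\cdots\wedge w_p) = \sum_{i<j} (-1)^{i+j}[w_i,w_j]\wedge w_1\wedge\cdots\wedge\widehat{w_i}\wedge\cdots\wedge\widehat{w_j}\wedge\cdots\wedge w_p$ (so $H_0 = k$). *)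

(* Defs.v *)
From HB Require Import structures.
From mathcomp Require Import all_boot all_order all_algebra.
Set Implicit Arguments. Unset Strict Implicit. Unset Printing Implicit Defensive.
Import Order.TTheory GRing.Theory Num.Theory.
Local Open Scope ring_scope.

(* Dimension of the Heisenberg Lie algebra h_n : 2n+1.
   Basis indexed by 'I_(2n+1):  index 0 = z,  index m (1<=m<=n) = x_m,
   index m+n (1<=m<=n) = y_m. *)
Definition hdim (n : nat) : nat := (n.*2).+1.

Section Heisenberg.
Variables (k : fieldType) (n : nat).

Local Notation B := 'I_(hdim n).

(* structure constants: [w_i, w_j] = \sum_c heis_br i j c * w_c *)
Definition heis_br (i j c : B) : k :=
  if (c : nat) == 0%N then
    if [&& (1 <= i)%N, (i <= n)%N & (j : nat) == (i + n)%N] then 1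
    else if [&& (1 <= j)%N, (j <= n)%N & (i : nat) == (j + n)%N] then -1
    else 0
  else 0.

Definition pos (S : {set B}) (s : B) : nat := #|[set t in S | (t < s)%N]|.

(* The exterior algebra \bigwedge h_n, with basis e_S = w_{s_1}/\.../\w_{s_p}
   (s_1 < ... < s_p) indexed by subsets S, realized as row vectors of length
   #|{set B}| (index r <-> subset enum_val r).  The Chevalley-Eilenberg
   differential as a matrix acting on row vectors: row S of CE_mx is d(e_S):
   d(e_S) = \sum_{a<b} (-1)^{a+b} [w_{s_a}, w_{s_b}] /\ e_{S \ {s_a,s_b}}
   where c /\ e_T = (-1)^{#{t in T | t < c}} e_{T u {c}} for c \notin T. *)
Definition CE_mx : 'M[k]_(#|{set B}|) :=
  \matrix_(r < #|{set B}|, s < #|{set B}|)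
    let S : {set B} := enum_val r in let U : {set B} := enum_val s in
    \sum_(i in S) \sum_(j in S | (i < j)%N) \sum_(c : B | c \notin (S :\ i :\ j))
      (if U == c |: (S :\ i :\ j) then
         (-1) ^+ (pos S i + pos S j) * heis_br i j c
         * (-1) ^+ (pos (S :\ i :\ j) c)
       else 0).

(* projector whose row space is \bigwedge^p h_n *)
Definition CE_deg (p : nat) : 'M[k]_(#|{set B}|) :=
  \matrix_(r < #|{set B}|, s < #|{set B}|) (if (r == s) && (#|(enum_val r : {set B})| == p) then 1 else 0).

Definition heis_homology_dim (p : nat) : nat :=
  (\rank (CE_deg p :&: kermx CE_mx)%MS - \rank (CE_deg p.+1 *m CE_mx))%N.

End Heisenberg.

(* Main.v *)
(* In characteristic 2 the signs disappear: d kills z /\ w, and for a monomial w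
   in the x's and y's, d w is the sum of z /\ w' where w' runs over the monomials
   obtained from w by deleting one pair x_i y_i.  An index i is paired in w when
   x_i and y_i both occur or both do not.  Inserting the pair at a chosen paired
   index gives a map h, with d h d = d, which matches the monomials whose chosen
   paired index is empty with those for which it is full.  Hence the rank of d
   in degree p is the number f_p of monomials of the latter kind, and
   dim H_p = C(2n+1,p) - f_p - f_(p+1).  The matching raises degrees by 2, and
   the monomials without paired index are 2^n in number, all of degree n; so
   f_(p+2) + f_p = C(2n,p) - [p = n] 2^n, which gives the rational function. *)
Require Import Defs.
From HB Require Import structures.
From mathcomp Require Import all_boot all_order all_algebra.
From mathcomp Require Import zify ring.
Import Order.TTheory GRing.Theory Num.Theory.
Local Open Scope ring_scope.
Set Implicit Arguments. Unset Strict Implicit. Unset Printing Implicit Defensive.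

(** * Linear algebra: coordinate projectors and cancellation in characteristic 2 *)

Lemma mxrank_diag_pred (k : fieldType) (N : nat) (P : pred 'I_N) :
  \rank (\matrix_(r < N, s < N) (if (r == s) && P r then 1 else 0 : k)) = #|P|.
Proof.
set D := (X in \rank X).
(* The rows of [A] are the basis vectors selected by [P], so [D] factors as [A^T *m A] with
   [A *m A^T = 1]. *)
pose A : 'M[k]_(#|P|, N) := \matrix_(a, s) (enum_val a == s)%:R.
have AA : A *m A^T = 1%:M.
  apply/matrixP=> a b; rewrite !mxE (bigD1 (enum_val a)) //= big1 => [|s nas].
    by rewrite !mxE eqxx mul1r addr0 (inj_eq enum_val_inj) eq_sym.
  by rewrite !mxE eq_sym (negPf nas) mul0r.
have DA : D = A^T *m A.
  apply/matrixP=> r s; rewrite !mxE; case: (boolP (P r)) => Pr; last first.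
    rewrite andbF big1 // => a _; rewrite !mxE.
    case: eqP => [ar|_]; last by rewrite mul0r.
    by case/negP: Pr; rewrite -ar; exact: (enum_valP a).
  rewrite andbT (bigD1 (enum_rank_in Pr r)) //= big1 => [|a nar].
    by rewrite !mxE enum_rankK_in // eqxx mul1r addr0; case: eqP.
  rewrite !mxE; case: eqP => [ar|_]; last by rewrite mul0r.
  case/negP: nar; apply/eqP/enum_val_inj.
  by rewrite enum_rankK_in.
apply/eqP; rewrite eqn_leq; apply/andP; split.
  by rewrite DA (leq_trans (mxrankM_maxr _ _)) // rank_leq_row.
have -> : #|P| = \rank (A *m D *m A^T).
  by rewrite DA mulmxA AA mul1mx AA mxrank1.
by rewrite (leq_trans (mxrankM_maxl _ _)) // mxrankM_maxr.
Qed.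

(** The terms at (i, j) and (j, i) are equal and cancel; [enum_rank] supplies an order that picks
    one of the two. *)
Lemma sum_offdiag_sym_pchar2 (k : fieldType) (V : lmodType k) (I : finType)
    (P : pred I) (g : I -> I -> V) :
  2 \in [pchar k] -> (forall i j, g i j = g j i) ->
  \sum_(i | P i) \sum_(j | P j && (j != i)) g i j = 0.
Proof.
move=> ch gC.
have addvv (v : V) : v + v = 0.
  by rewrite -[v]scale1r -scalerDl (addrr_pchar2 ch) scale0r.
have -> : \sum_(i | P i) \sum_(j | P j && (j != i)) g i j =
    \sum_(i | P i) \sum_(j | P j) (if (enum_rank i < enum_rank j)%N then g i j else 0)
  + \sum_(i | P i) \sum_(j | P j) (if (enum_rank j < enum_rank i)%N then g i j else 0).
  rewrite -big_split; apply: eq_bigr => i Pi /=; rewrite -big_split big_mkcondr /=.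
  apply: eq_bigr => j Pj; rewrite -(inj_eq enum_rank_inj) -val_eqE neq_ltn.
  by case: ltngtP; rewrite ?addr0 ?add0r.
rewrite [X in _ + X]exchange_big /=.
under [X in _ + X]eq_bigr do under eq_bigr do rewrite gC.
exact: addvv.
Qed.

(** * Subsets of the basis and their pairs x_i, y_i *)

Section Pairs.
Variable n : nat.
Local Notation B := 'I_(hdim n).

Definition hz : B := @ord0 n.*2.
(** Indices start at 0, so [hx i] and [hy i] are x_{i+1} and y_{i+1}. *)
Definition hx (i : 'I_n) : B := @inord n.*2 i.+1.
Definition hy (i : 'I_n) : B := @inord n.*2 (i + n).+1.

Lemma val_hx i : hx i = i.+1 :> nat.
Proof. by rewrite inordK //; have := ltn_ord i; lia. Qed.

Lemma val_hy i : hy i = (i + n).+1 :> nat.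
Proof. by rewrite inordK //; have := ltn_ord i; lia. Qed.

Lemma hx_inj : injective hx.
Proof. by move=> i j /(congr1 val) /=; rewrite !val_hx => -[] /val_inj. Qed.

Lemma hy_inj : injective hy.
Proof.
by move=> i j /(congr1 val) /=; rewrite !val_hy => -[] /addIn /val_inj.
Qed.

Lemma hxy i j : (hx i == hy j) = false.
Proof.
apply/eqP=> /(congr1 val) /=; rewrite val_hx val_hy.
by have := ltn_ord i; lia.
Qed.

Lemma hyx i j : (hy i == hx j) = false.
Proof. by rewrite eq_sym hxy. Qed.

Lemma hzx i : (hz == hx i) = false.
Proof. by apply/eqP=> /(congr1 val) /=; rewrite val_hx. Qed.

Lemma hzy i : (hz == hy i) = false.
Proof. by apply/eqP=> /(congr1 val) /=; rewrite val_hy. Qed.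

Lemma hxz i : (hx i == hz) = false.
Proof. by rewrite eq_sym hzx. Qed.

Lemma hyz i : (hy i == hz) = false.
Proof. by rewrite eq_sym hzy. Qed.

Definition heqE := (hxy, hyx, hzx, hzy, hxz, hyz, inj_eq hx_inj, inj_eq hy_inj,
  eqxx).

Variant hbasis_spec (b : B) : Prop :=
| HbasisZ of b = hz
| HbasisX i of b = hx i
| HbasisY i of b = hy i.

Lemma hbasisP b : hbasis_spec b.
Proof.
case: (posnP b) => [b0|b_gt0]; first by apply/HbasisZ/val_inj.
have b_le : (nat_of_ord b < (n + n).+1)%N by rewrite addnn; exact: ltn_ord b.
case: (leqP b n) => bn.
  have lt : (b.-1 < n)%N by lia.
  by apply: (@HbasisX _ (Ordinal lt)); apply/val_inj; rewrite /= val_hx /=; lia.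
have lt : (b.-1 - n < n)%N by lia.
by apply: (@HbasisY _ (Ordinal lt)); apply/val_inj; rewrite /= val_hy /=; lia.
Qed.

Implicit Types (S : {set B}) (i j : 'I_n).

Definition full S i := (hx i \in S) && (hy i \in S).
Definition paired S i := (hx i \in S) == (hy i \in S).
Definition rmpair i S := S :\ hx i :\ hy i.
Definition addpair i S := hx i |: (hy i |: S).

(* Any extensional choice of a paired index works here: what matters is that
   adding or removing a pair does not change the set of paired indices. *)
Definition lead S := [pick i | paired S i].

Definition lead_full S := (hz \notin S) && (if lead S is Some i then hx i \in S else false).
Definition lead_empty S := (hz \notin S) && (if lead S is Some i then hx i \notin S else false).
Definition unpaired S := (hz \notin S) && (lead S == None).

Definition hinE := (in_setU1, in_setD1, heqE).

Lemma paired_rmpair j S i : full S j -> paired (rmpair j S) i = paired S i.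
Proof.
move=> /andP[xj yj]; rewrite /paired !hinE /=.
by case: (eqVneq i j) => [->|] //=; rewrite xj yj.
Qed.

Lemma paired_addpair j S i :
  paired S j -> hx j \notin S -> paired (addpair j S) i = paired S i.
Proof.
rewrite /paired => /eqP pj xj; rewrite !hinE /=.
by case: (eqVneq i j) => [->|] //=; rewrite -pj (negPf xj).
Qed.

Lemma paired_addz S i : paired (hz |: S) i = paired S i.
Proof. by rewrite /paired !hinE. Qed.

Lemma lead_rmpair j S : full S j -> lead (rmpair j S) = lead S.
Proof. by move=> fj; apply: eq_pick => i; exact: paired_rmpair. Qed.

Lemma lead_addpair j S :
  paired S j -> hx j \notin S -> lead (addpair j S) = lead S.
Proof. by move=> pj xj; apply: eq_pick => i; exact: paired_addpair. Qed.

Lemma lead_addz S : lead (hz |: S) = lead S.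
Proof. by apply: eq_pick => i; exact: paired_addz. Qed.

Lemma lead_some S i : lead S = Some i -> paired S i.
Proof. by rewrite /lead; case: pickP => // j pj [<-]. Qed.

Lemma lead_none S i : lead S = None -> paired S i = false.
Proof. by rewrite /lead; case: pickP. Qed.

Lemma addpairK i S : paired S i -> hx i \notin S -> rmpair i (addpair i S) = S.
Proof.
move=> /eqP pj xj; apply/setP=> b; rewrite !in_setD1 !in_setU1.
case: (eqVneq b (hx i)) => [->|_] /=; first by rewrite andbF (negPf xj).
by case: (eqVneq b (hy i)) => [->|_] //=; rewrite -pj (negPf xj).
Qed.

Lemma rmpairK i S : full S i -> addpair i (rmpair i S) = S.
Proof.
move=> /andP[xj yj]; apply/setP=> b; rewrite !in_setU1 !in_setD1.
case: (eqVneq b (hx i)) => [->|_] /=; first by rewrite xj.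
by case: (eqVneq b (hy i)) => [->|_].
Qed.

Lemma card_addpair i S :
  paired S i -> hx i \notin S -> #|addpair i S| = #|S|.+2.
Proof.
by move=> /eqP pj xj; rewrite !cardsU1 !hinE /= -pj (negPf xj).
Qed.

Lemma card_rmpair i S : full S i -> #|S| = #|rmpair i S|.+2.
Proof.
move=> /andP[xj yj]; rewrite (cardsD1 (hx i) S) (cardsD1 (hy i) (S :\ _)).
by rewrite !hinE xj yj.
Qed.

Lemma lead_full_full S i : lead_full S -> lead S = Some i -> full S i.
Proof.
by move=> /andP[_] + li; rewrite li /full => xi; have /eqP <- := lead_some li; rewrite xi.
Qed.

Lemma lead_full_addpair i S :
  lead_empty S -> lead S = Some i -> lead_full (addpair i S).
Proof.
case/andP=> zS + li; rewrite li => xi.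
by rewrite /lead_full lead_addpair ?(lead_some li) // li !hinE (negPf zS).
Qed.

Lemma lead_empty_rmpair i S :
  lead_full S -> lead S = Some i -> lead_empty (rmpair i S).
Proof.
move=> FS li; have fi := lead_full_full FS li; case/andP: FS => zS _.
by rewrite /lead_empty lead_rmpair // li !hinE (negPf zS).
Qed.

(** * Counting the three classes of monomials by degree *)

Definition nfull p := #|[set S | lead_full S & #|S| == p]|.
Definition nempty p := #|[set S | lead_empty S & #|S| == p]|.
Definition nunpaired p := #|[set S | unpaired S & #|S| == p]|.

(** Inserting and deleting the pair at the lead index are inverse bijections, because neither
    operation changes [lead]. *)
Lemma nfullSS p : nfull p.+2 = nempty p.
Proof.
pose add S := if lead S is Some i then addpair i S else S.
pose rem S := if lead S is Some i then rmpair i S else S.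
apply/esym; rewrite /nfull /nempty.
rewrite -(@card_in_imset _ _ add); last first.
  apply: (can_in_inj (g := rem)) => S; rewrite inE => /andP[ES _].
  rewrite /add /rem; case li: (lead S) => [i|]; last by rewrite li.
  case/andP: ES; rewrite li => zS xi.
  by rewrite lead_addpair ?(lead_some li) // li addpairK // (lead_some li).
congr #|pred_of_set _|; apply/setP=> T; apply/imsetP/idP => [[S]|].
  rewrite !inE => /andP[ES /eqP cS] ->; rewrite /add.
  case li: (lead S) => [i|]; last by case/andP: ES; rewrite li.
  rewrite (lead_full_addpair ES) //= card_addpair ?cS ?(lead_some li) //.
  by case/andP: ES; rewrite li.
rewrite !inE => /andP[FT /eqP cT]; exists (rem T).
  rewrite /rem inE; case li: (lead T) => [i|]; last by case/andP: FT; rewrite li.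
  by rewrite lead_empty_rmpair //=; move: cT; rewrite (card_rmpair (lead_full_full FT li)) => -[->].
rewrite /rem /add; case li: (lead T) => [i|]; last by rewrite li.
have fi := lead_full_full FT li.
by rewrite lead_rmpair // li rmpairK.
Qed.

Lemma nfull_small p : (p < 2)%N -> nfull p = 0%N.
Proof.
move=> p2; apply: eq_card0 => S; rewrite inE; apply/negP=> /andP[FS /eqP cS].
case li: (lead S) => [i|]; last by case/andP: FS; rewrite li.
by move: p2; rewrite -cS (card_rmpair (lead_full_full FS li)).
Qed.

(** The three classes partition the subsets that avoid z, and these are drawn from 2n basis
    elements. *)
Lemma card_parts p : (nfull p + nempty p + nunpaired p)%N = 'C(n.*2, p).
Proof.
have <- : #|[set~ hz]| = n.*2 by rewrite cardsC1 card_ord.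
rewrite -cards_draws /nfull /nempty /nunpaired -!sum1dep_card.
rewrite [RHS](bigID lead_full) /= -addnA; congr (_ + _)%N.
  apply: eq_bigl => S; rewrite /lead_full subsetC sub1set inE.
  by case: (_ \in _) => //=; rewrite andbC.
rewrite [RHS](bigID lead_empty) /=; congr (_ + _)%N; apply: eq_bigl => S;
  rewrite /unpaired /lead_empty /lead_full subsetC sub1set inE;
  by case: (_ \in _); case: (_ == p); case: (lead S) => [i|] //=; case: (_ \in _).
Qed.

Lemma unpaired_iff S : unpaired S = (hz \notin S) && [forall i, ~~ paired S i].
Proof.
rewrite /unpaired; congr (_ && _); rewrite /lead; case: pickP => [i pi|np].
  by apply/esym/forallP => /(_ i); rewrite pi.
by apply/esym/forallP => i; rewrite np.
Qed.

(** Without a paired index, exactly one of x_i, y_i occurs for every i. Such a set is [sel A], with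
    [A] the set of indices whose x_i occurs. *)
Lemma nunpairedE p : nunpaired p = if p == n then (2 ^ n)%N else 0%N.
Proof.
pose sel (A : {set 'I_n}) := hx @: A :|: hy @: ~: A.
have selx A i : (hx i \in sel A) = (i \in A).
  rewrite in_setU mem_imset; last exact: hx_inj.
  case: imsetP => [[j _ /eqP]|]; first by rewrite heqE.
  by rewrite orbF.
have sely A i : (hy i \in sel A) = (i \notin A).
  rewrite in_setU (mem_imset _ _ hy_inj) inE.
  by case: imsetP => [[j _ /eqP]|]; first by rewrite heqE.
have selz A : hz \notin sel A.
  by rewrite in_setU; apply/norP; split; apply/imsetP => -[j _ /eqP]; rewrite heqE.
have card_sel A : #|sel A| = n.
  rewrite cardsU disjoint_setI0 ?cards0 ?subn0; last first.
    rewrite -setI_eq0; apply/eqP/setP=> b; rewrite !inE.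
    apply/negP=> /andP[/imsetP[i _ ->] /imsetP[j _ /eqP]].
    by rewrite heqE.
  by rewrite !card_imset ?cardsC ?card_ord //; [exact: hy_inj|exact: hx_inj].
have unp S : unpaired S = (S \in sel @: setT).
  rewrite unpaired_iff; apply/idP/imsetP => [/andP[zS /forallP up]|[A _ ->]].
    exists [set i | hx i \in S] => //; apply/setP=> b.
    case: (hbasisP b) => [|i|i] ->.
    - by rewrite (negPf (selz _)) (negPf zS).
    - by rewrite selx inE.
    rewrite sely inE; have := up i; rewrite /paired.
    by case: (_ \in S); case: (_ \in S).
  rewrite selz; apply/forallP=> i; rewrite /paired selx sely.
  by case: (_ \in _).
have sel_inj : injective sel.
  by move=> A A' eqA; apply/setP=> i; rewrite -!selx eqA.
have -> : nunpaired p = #|[set S in sel @: setT | #|S| == p]|.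
  by apply: eq_card => S; rewrite !inE unp.
case: eqP => [->|np].
  have -> : [set S in sel @: setT | #|S| == n] = sel @: setT.
    apply/setP=> S; rewrite inE andb_idr // => /imsetP[A _ ->].
    by rewrite card_sel.
  by rewrite card_imset // -powersetT card_powerset cardsT card_ord.
apply: eq_card0 => S; rewrite inE; apply/negP=> /andP[/imsetP[A _ ->]].
by rewrite card_sel => /eqP /esym.
Qed.

End Pairs.

(** * The differential in characteristic 2 and its partial inverse *)

Section Differential.
Variables (k : fieldType) (n : nat).
Hypothesis ch2 : 2 \in [pchar k].
Local Notation B := 'I_(hdim n).
Local Notation N := #|{set B}|.
Local Notation d := (CE_mx k n).
Implicit Types (S U : {set B}) (i j : 'I_n).

Definition ebasis S : 'rV[k]_N := delta_mx 0 (enum_rank S).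

Lemma ebasis_eq (M M' : 'M[k]_N) :
  (forall S, ebasis S *m M = ebasis S *m M') -> M = M'.
Proof.
move=> eqM; apply/row_matrixP => r.
by rewrite !rowE -[r]enum_valK; exact: eqM.
Qed.

Definition ediag (P : pred {set B}) : 'M[k]_N :=
  \matrix_(r, s) (if (r == s) && P (enum_val r) then 1 else 0).

Lemma ebasis_diag P S : ebasis S *m ediag P = if P S then ebasis S else 0.
Proof.
rewrite -rowE; apply/rowP=> s; rewrite !mxE enum_rankK.
by case: (P S); rewrite ?andbT ?andbF !mxE // eq_sym; case: eqP.
Qed.

Lemma mxrank_ediag P : \rank (ediag P) = #|[set S | P S]|.
Proof.
rewrite mxrank_diag_pred -(card_imset _ enum_val_inj).
apply: eq_card => S; rewrite inE; apply/imsetP/idP => [[r Pr ->] //|PS].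
by exists (enum_rank S); rewrite ?enum_rankK // unfold_in /= enum_rankK.
Qed.

Lemma heis_br_pairs (a b : B) : (a < b)%N ->
  heis_br k a b (hz n) = \sum_i ((a == hx i) && (b == hy i))%:R.
Proof.
move=> ab; rewrite /heis_br /=; case: ifP => [/and3P[a1 an /eqP eb]|nab].
  have lt : (a.-1 < n)%N by lia.
  pose i0 := Ordinal lt.
  have ea : a = hx i0 by apply/val_inj; rewrite /= val_hx /= prednK.
  have eb' : b = hy i0 by apply/val_inj; rewrite /= val_hy /= eb; lia.
  rewrite (bigD1 i0) //= big1 ?addr0 => [|i ni]; rewrite ea eb' ?eqxx //.
  by rewrite !heqE andbb eq_sym (negPf ni).
(* The order [a < b] rules out the branch with value -1. *)
rewrite ifF; last by apply/negP=> /and3P[_ _ /eqP]; lia.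
rewrite big1 // => i _; case: andP => // -[/eqP ea /eqP eb]; case/negP: nab.
by rewrite ea eb val_hx val_hy eqxx ltn_ord.
Qed.

Lemma ebasis_d S : ebasis S *m d =
  if hz n \in S then 0 else \sum_(i | full S i) ebasis (hz n |: rmpair i S).
Proof.
rewrite -rowE; apply/rowP=> s; rewrite !mxE enum_rankK.
set U := enum_val s.
have sgn m : (-1 : k) ^+ m = 1 by rewrite (oppr_pchar2 ch2) expr1n.
pose br (a b : B) := heis_br k a b (hz n).
(* All brackets are multiples of z, so only the term c = z survives. *)
have inner (a b : B) :
  \sum_(c : B | c \notin S :\ a :\ b)
     (if U == c |: (S :\ a :\ b) then
       (-1) ^+ (pos S a + pos S b) * heis_br k a b c * (-1) ^+ pos (S :\ a :\ b) c
      else 0)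
  = if (hz n \notin S :\ a :\ b) && (U == hz n |: (S :\ a :\ b)) then br a b else 0.
  rewrite big_mkcond (bigD1 (hz n)) //= big1 ?addr0 => [|c nc].
    by case: (_ \notin _) => //=; case: (_ == _); rewrite // !sgn mul1r mulr1.
  have c0 : ((c : nat) == 0%N) = false.
    by apply/eqP=> c0; case/eqP: nc; apply/val_inj.
  rewrite /heis_br c0.
  by rewrite mulr0 mul0r; case: (_ == _); case: (_ \notin _).
pose g i : k := ((hz n \notin rmpair i S) && (U == hz n |: rmpair i S))%:R.
transitivity (\sum_(a in S) \sum_(b in S | (a < b)%N)
    \sum_i (if (a == hx i) && (b == hy i) then g i else 0)).
  apply: eq_bigr => a aS; apply: eq_bigr => b /andP[bS ab].
  rewrite inner /br heis_br_pairs //; case: ifPn => C; [|apply/esym/big1 => i _].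
    apply: eq_bigr => i _; case: andP => // -[/eqP ea /eqP eb].
    by rewrite /g /rmpair -ea -eb C.
  case: andP => // -[/eqP ea /eqP eb].
  by rewrite /g /rmpair -ea -eb (negPf C).
under eq_bigr do rewrite exchange_big /=.
rewrite exchange_big /=.
transitivity (\sum_(i | full S i) g i).
  rewrite [RHS]big_mkcond /=; apply: eq_bigr => i _; case: ifPn => fi.
    have /andP[xi yi] := fi.
    rewrite (bigD1 (hx i)) //= [X in _ + X]big1 ?addr0 => [|a /andP[_ /negPf na]].
      (* As x_i precedes y_i, a full pair enters the sum over [a < b] exactly once. *)
      have lt : (hx i < hy i)%N by rewrite val_hx val_hy; have := ltn_ord i; lia.
      rewrite (bigD1 (hy i)) /= ?yi ?lt //.
      rewrite big1 ?addr0 ?eqxx //= => b /andP[_ /negPf nb].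
      by rewrite nb ?andbF.
    by rewrite big1 // => b _; rewrite na.
  rewrite big1 // => a aS; rewrite big1 // => b /andP[bS _].
  case: andP => // -[/eqP ea /eqP eb]; case/negP: fi.
  by rewrite /full -ea -eb aS.
(* Deleting a pair leaves z in place; when z is already in [S], the wedge with z is zero. *)
rewrite /g; case: ifPn => zS.
  by rewrite mxE big1 // => i _; rewrite !hinE /= zS.
rewrite summxE; apply: eq_bigr => i _; rewrite !hinE /= (negPf zS) /= mxE eqxx /=.
by rewrite /U (can2_eq enum_valK enum_rankK).
Qed.

(** This is h on basis vectors: z is traded for the lead pair if that pair is empty, which raises
    the degree by 1. Rows are multiplied on the right, so [d *m hmx] applies d first. *)
Definition hmap S : 'rV[k]_N :=
  if hz n \in S then
    if lead S is Some i then
      if hx i \notin S then ebasis (addpair i (S :\ hz n)) else 0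
    else 0
  else 0.

Definition hmx : 'M[k]_N := \matrix_(r, s) hmap (enum_val r) 0 s.

Lemma ebasis_h S : ebasis S *m hmx = hmap S.
Proof. by rewrite -rowE; apply/rowP=> s; rewrite !mxE enum_rankK. Qed.

Lemma ebasis_dh S i : hz n \notin S -> lead S = Some i ->
  ebasis S *m d *m hmx =
  \sum_(j | full S j)
    (if hx i \notin rmpair j S then ebasis (addpair i (rmpair j S)) else 0).
Proof.
move=> zS li; rewrite ebasis_d (negPf zS) mulmx_suml; apply: eq_bigr => j fj.
rewrite ebasis_h /hmap lead_addz lead_rmpair // li !hinE /= setU1K //.
by rewrite !hinE.
Qed.

(** Among the terms of d, only the one that deletes the lead pair has an empty lead pair; h restores
    the pair there and kills every other term. *)
Lemma ebasis_dh_lead_full S : lead_full S -> ebasis S *m d *m hmx = ebasis S.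
Proof.
move=> FS; have /andP[zS] := FS; case li: (lead S) => [i|] // xi.
have fi := lead_full_full FS li.
rewrite (ebasis_dh zS li) (bigD1 i) //= big1 ?addr0 => [|j /andP[_ nj]].
  by rewrite !hinE /= rmpairK.
by rewrite !hinE /= eq_sym nj xi.
Qed.

Lemma ebasis_dh_lead_empty S i : lead_empty S -> lead S = Some i ->
  ebasis S *m d *m hmx = \sum_(j | full S j) ebasis (addpair i (rmpair j S)).
Proof.
case/andP=> zS + li; rewrite li => xi; rewrite (ebasis_dh zS li).
by apply: eq_bigr => j _; rewrite !hinE /= (negPf xi) !andbF.
Qed.

Lemma full_rmpair S i j : full (rmpair j S) i = (i != j) && full S i.
Proof. by rewrite /full !hinE /=; case: (i != j). Qed.

Lemma full_addpair S i j : full (addpair j S) i = (i == j) || full S i.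
Proof. by rewrite /full !hinE /=; case: (i == j). Qed.

Lemma rmpair_addpairC S i j :
  i != j -> rmpair j (addpair i S) = addpair i (rmpair j S).
Proof.
move=> nij; apply/setP=> b; rewrite !in_setD1 !in_setU1 !in_setD1.
case: (eqVneq b (hx i)) => [->|_]; first by rewrite !heqE nij.
by case: (eqVneq b (hy i)) => [->|_]; rewrite // !heqE nij.
Qed.

Lemma rmpairC S i j : rmpair i (rmpair j S) = rmpair j (rmpair i S).
Proof.
by apply/setP=> b; rewrite !in_setD1; do 4!case: (b != _); rewrite ?andbF.
Qed.

(** After h d, each term has lost a pair j and gained the lead pair i. Applying d again, deletion of
    i gives back the terms of d, while deletion of another l gives terms symmetric in j and l, which
    cancel. *)
Lemma ebasis_dhd_lead_empty S :
  lead_empty S -> ebasis S *m d *m hmx *m d = ebasis S *m d.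
Proof.
move=> ES; have /andP[zS] := ES; case li: (lead S) => [i|] // xi.
have nfi j : full S j -> i != j.
  by apply: contraTneq => <-; rewrite /full (negPf xi).
rewrite (ebasis_dh_lead_empty ES li) mulmx_suml ebasis_d (negPf zS).
pose g j l := ebasis (hz n |: addpair i (rmpair l (rmpair j S))).
transitivity (\sum_(j | full S j) (ebasis (hz n |: rmpair j S)
   + \sum_(l | full S l && (l != j)) g j l)).
  apply: eq_bigr => j fj; have nij := nfi j fj.
  have xij : hx i \notin rmpair j S by rewrite !hinE /= (negPf xi) !andbF.
  have pij : paired (rmpair j S) i by rewrite paired_rmpair // lead_some.
  rewrite ebasis_d !hinE /= (negPf zS) (bigD1 i) /=; last first.
    by rewrite full_addpair eqxx.
  rewrite addpairK //; congr (_ + _); apply: eq_big => [l|l].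
    rewrite full_addpair full_rmpair; case: (eqVneq l i) => [->|_] /=.
      by rewrite /full (negPf xi).
    by rewrite andbT andbC.
  by case/andP => _ nli; rewrite rmpair_addpairC // eq_sym.
rewrite big_split /= [X in _ + X](sum_offdiag_sym_pchar2 _ ch2) ?addr0 //.
by move=> j l; rewrite /g rmpairC.
Qed.

Lemma ebasis_d_unpaired S : unpaired S -> ebasis S *m d = 0.
Proof.
rewrite unpaired_iff => /andP[zS /forallP up].
rewrite ebasis_d (negPf zS) big1 // => i /andP[xi yi].
by have := up i; rewrite /paired xi yi.
Qed.

(** * Ranks in each degree and the homology dimension *)

Lemma CE_degE p : CE_deg k n p = ediag (fun S => #|S| == p).
Proof. by apply/matrixP=> r s; rewrite !mxE. Qed.

Lemma mxrank_CE_deg p : \rank (CE_deg k n p) = 'C((n.*2).+1, p).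
Proof.
by rewrite CE_degE mxrank_ediag card_draws card_ord.
Qed.

Lemma mxrank_CE_deg_d p : \rank (CE_deg k n p *m d) = nfull n p.
Proof.
pose P S := lead_full S && (#|S| == p).
rewrite -[RHS](mxrank_ediag P) CE_degE; set Q := ediag _.
apply/eqP; rewrite eqn_leq; apply/andP; split.
  (* Upper bound: d h d = d in degree p, and h d lands in the span of the lead-full monomials of
     degree p. *)
  suff -> : Q *m d = Q *m d *m hmx *m ediag P *m d.
    by rewrite (leq_trans (mxrankM_maxl _ _)) // mxrankM_maxr.
  apply: ebasis_eq => S; rewrite !mulmxA ebasis_diag.
  case: eqP => [cS|_]; last by rewrite !mul0mx.
  have [zS|zS] := boolP (hz n \in S).
    by rewrite ebasis_d zS !mul0mx.
  have [FS|nFS] := boolP (lead_full S).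
    by rewrite ebasis_dh_lead_full // ebasis_diag /P FS cS eqxx.
  (* With z absent, the only remaining class is the unpaired one, where d vanishes. *)
  have [ES|nES] := boolP (lead_empty S); last first.
    rewrite ebasis_d_unpaired ?mul0mx //.
    move: nFS nES; rewrite /lead_full /lead_empty /unpaired zS /=.
    by case: (lead S) => // i ->.
  rewrite -[LHS]ebasis_dhd_lead_empty //; congr (_ *m d).
  have /andP[_] := ES; case li: (lead S) => [i|] // xi.
  rewrite (ebasis_dh_lead_empty ES li) mulmx_suml; apply: eq_bigr => j fj.
  have xij : hx i \notin rmpair j S by rewrite !hinE /= (negPf xi) !andbF.
  have pij : paired (rmpair j S) i by rewrite paired_rmpair // lead_some.
  rewrite ebasis_diag /P card_addpair // -(card_rmpair fj) cS eqxx andbT.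
  by rewrite /lead_full lead_addpair // lead_rmpair // li !hinE /= (negPf zS).
(* Lower bound: h d is the identity on the lead-full monomials. *)
suff -> : ediag P = ediag P *m (Q *m d) *m hmx.
  by rewrite (leq_trans (mxrankM_maxl _ _)) // mxrankM_maxr.
apply: ebasis_eq => S; rewrite !mulmxA ebasis_diag.
case: ifP => [/andP[FS cS]|_]; last by rewrite !mul0mx.
by rewrite ebasis_diag cS ebasis_dh_lead_full.
Qed.

(** Rank-nullity for d restricted to degree p. *)
Lemma heis_homology_dimE p :
  heis_homology_dim k n p = ('C((n.*2).+1, p) - nfull n p - nfull n p.+1)%N.
Proof.
rewrite /heis_homology_dim mxrank_CE_deg_d -(mxrank_CE_deg p) -(mxrank_CE_deg_d p).
by rewrite -(mxrank_mul_ker (CE_deg k n p) d) addKn.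
Qed.

End Differential.

(** * Generating functions *)

Lemma coef_binomial (m i : nat) : ((1 + 'X) ^+ m : {poly int})`_i = 'C(m, i)%:Z.
Proof.
elim: m i => [|m IH] [|i]; rewrite ?expr0 ?coef1 //.
  by rewrite exprS mulrDl mul1r coefD coefXM IH addr0 !bin0.
by rewrite exprS mulrDl mul1r coefD coefXM /= !IH binS PoszD.
Qed.

Section EmptyPoly.
Variable n : nat.

(** The cutoff loses nothing, as [card_parts] bounds the coefficients by binomials that vanish
    beyond 2n. *)
Definition empty_poly : {poly int} := \poly_(i < (n.*2).+1) (nempty n i)%:Z.

Lemma coef_empty_poly i : empty_poly`_i = (nempty n i)%:Z.
Proof.
rewrite coef_poly; case: ltnP => // ltni; have := card_parts n i.
by rewrite bin_small //; case: (nempty n i) => // m; lia.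
Qed.

(** By [nfullSS], multiplication by X^2 turns the lead-empty count into the lead-full one. The sum
    of both is all subsets avoiding z minus the unpaired ones, whose series is (2X)^n. *)
Lemma empty_poly_mul :
  empty_poly * (1 + 'X^2) = (1 + 'X) ^+ n.*2 - (2%:P * 'X) ^+ n.
Proof.
apply/polyP=> i; rewrite mulrDr mulr1 coefD coefMXn coefB coef_binomial.
rewrite exprMn -polyC_exp coefCM coefXn !coef_empty_poly -(card_parts n i) nunpairedE.
have -> : (if (i < 2)%N then 0 else (nempty n (i - 2)%N)%:Z) = (nfull n i)%:Z.
  case: i => [|[|i]] /=; last by rewrite subn2 nfullSS.
    by rewrite nfull_small //; reflexivity.
  by rewrite nfull_small //; reflexivity.
rewrite !PoszD; case: eqP => _; last by rewrite mulr0 subr0 addr0 addrC.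
by rewrite mulr1 -[(2 ^ n)%:Z]natz natrX; ring.
Qed.

End EmptyPoly.

Theorem mainTheorem1 (k : fieldType) (n : nat) :
  2%N \in [pchar k] -> (1 <= n)%N ->
  exists q : {poly int},
    q * (1 + 'X^2) =
      (1 + 'X^3) * (1 + 'X) ^+ (n.*2) + ('X + 'X^2) * (2%:P * 'X) ^+ n
    /\ forall i : nat, ((heis_homology_dim k n i)%:Z = q`_i).
Proof.
move=> ch2 _.
(* With E = [empty_poly n], the series of f_p is X^2 E and that of f_{p+1} is X E; the two
   corrections add up to X (1 + X) E. The numerator comes from (1 + X)(1 + X^2) - X (1 + X) = 1 +
   X^3. *)
exists ((1 + 'X) ^+ (n.*2).+1 - 'X * ((1 + 'X) * empty_poly n)); split.
  rewrite mulrBl -!mulrA empty_poly_mul exprS.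
  by move: (_ ^+ n.*2) (_ ^+ n) => A B; ring.
move=> i; rewrite heis_homology_dimE // coefB coef_binomial coefXM.
rewrite mulrDl mul1r coefD coefXM !coef_empty_poly -!nfullSS.
case: i => [|i]; first by rewrite /= !nfull_small // !subn0 subr0.
(* The default 0 of the shifted coefficient agrees with f_1 = 0. *)
have -> : (if i == 0%N then 0 else (nfull n i.-1.+2)%:Z) = (nfull n i.+1)%:Z.
  by case: i => [|i] //=; rewrite nfull_small //; reflexivity.
(* This bound keeps the natural-number subtractions from truncating; it follows from Pascal's rule
   and [card_parts] in degrees i and i + 1. *)
have : (nfull n i.+1 + nfull n i.+2 <= 'C((n.*2).+1, i.+1))%N.
  by rewrite binS -(card_parts n i) -(card_parts n i.+1) nfullSS; lia.
by move=> le /=; lia.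
Qed.
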